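(* Let $\Lambda$ be a row-finite $k$-graph with no sources, and fix $c\in\underline{Z}^2(\Lambda,\mathbb{T})$. Let $\{s_\lambda:\lambda\in\Lambda\}$ be the universal generating Cuntz--Krieger $(\Lambda,c)$-family in $C^*(\Lambda,c)$. Then $s_\lambda\neq0$ for each $\lambda\in\Lambda$.
   Context: $k$-graphs. For a nonnegative integer $k$, a $k$-graph is a nonempty countable small category $\Lambda$ with a functor $d:\Lambda\to\mathbb{N}^k$ (the degree; $0\in\mathbb{N}$) with the factorisation property: whenever $d(\lambda)=m+n$ with $m,n\in\mathbb N^k$ there are unique $\mu,\nu\in\Lambda$ with $d(\mu)=m$, $d(\nu)=n$, $\lambda=\mu\nu$. Write $\Lambda^n=d^{-1}(n)$. The set $\Lambda^0$ is identified with the set of objects (identity morphisms), and $r,s:\Lambda\to\Lambda^0$ are codomain and domain. Put $v\Lambda^n=\{\lambda\in\Lambda^n:r(\lambda)=v\}$; $\Lambda$ is row-finite if every $v\Lambda^n$ is finite, and has no sources if every $v\Lambda^n$ is nonempty. Twisted $k$-graph algebras. $\mathbb{T}$ (unit circle) is written multiplicatively. $\Lambda^{*r}$ is the set of composable $r$-tuples. $\underline{Z}^2(\Lambda,\mathbb{T})$ is the group of functions $c:\Lambda^{*2}\to\mathbb{T}$ with $c(\lambda_1,\lambda_2)=1$ if $\lambda_1$ or $\lambda_2$ is in $\Lambda^0$, and $c(\lambda_1,\lambda_2)c(\lambda_1\lambda_2,\lambda_3)=c(\lambda_2,\lambda_3)c(\lambda_1,\lambda_2\lambda_3)$ on $\Lambda^{*3}$.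 A Cuntz--Krieger $(\Lambda,c)$-family in a $C^*$-algebra $B$ is a function $t:\Lambda\to B$ with: (CK1) $\{t_v:v\in\Lambda^0\}$ are mutually orthogonal projections; (CK2) $t_\mu t_\nu=c(\mu,\nu)t_{\mu\nu}$ whenever $s(\mu)=r(\nu)$; (CK3) $t_\lambda^*t_\lambda=t_{s(\lambda)}$; (CK4) $t_v=\sum_{\lambda\in v\Lambda^n}t_\lambda t_\lambda^*$ for all $v\in\Lambda^0,n\in\mathbb{N}^k$. $C^*(\Lambda,c)$ is the universal $C^*$-algebra generated by a Cuntz--Krieger $(\Lambda,c)$-family $\{s_\lambda\}$. *)

(* Defs.v *)
From HB Require Import structures.
From mathcomp Require Import all_boot all_order all_algebra.
From mathcomp Require Import all_classical all_reals all_analysis.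
From mathcomp Require Import complex.

Set Implicit Arguments.
Unset Strict Implicit.
Unset Printing Implicit Defensive.

Import Order.TTheory GRing.Theory Num.Theory.
Import numFieldNormedType.Exports.

Local Open Scope classical_set_scope.
Local Open Scope ring_scope.

(* C*-algebras need not have a unit (C*(Lambda, c) has none when Lambda has
   infinitely many objects), so they cannot be built on MathComp's rings; the
   product is added to a Banach space over the complex numbers R[i].  The norm
   `|x| takes its values in R[i]. *)
HB.mixin Record isCStarAlgebra (R : realType) A
    of CompleteNormedModule R[i] A := {
  cmul : A -> A -> A;
  cadj : A -> A;
  cmulA : associative cmul;
  cmulDl : left_distributive cmul +%R;
  cmulDr : right_distributive cmul +%R;
  cmulZl : forall (a : R[i]) (x y : A), cmul (a *: x) y = a *: cmul x y;
  cmulZr : forall (a : R[i]) (x y : A), cmul x (a *: y) = a *: cmul x y;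
  cadjK : involutive cadj;
  cadjD : {morph cadj : x y / x + y};
  cadjZ : forall (a : R[i]) (x : A), cadj (a *: x) = Num.conj a *: cadj x;
  cadjM : forall x y : A, cadj (cmul x y) = cmul (cadj y) (cadj x);
  cnormM_le : forall x y : A, `|cmul x y| <= `|x| * `|y|;
  cnorm_adjM : forall x : A, `|cmul (cadj x) x| = `|x| ^+ 2
}.

#[short(type="cstarAlgType")]
HB.structure Definition CStarAlgebra (R : realType) :=
  {A of isCStarAlgebra R A & CompleteNormedModule R[i] A}.

Declare Scope cstar_scope.
Delimit Scope cstar_scope with cstar.
Notation "x ** y" := (cmul x y)
  (at level 40, left associativity) : cstar_scope.
Notation "x ^#" := (cadj x) (at level 2, format "x ^#") : cstar_scope.
Local Open Scope cstar_scope.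

Definition star_hom (R : realType) (A B : cstarAlgType R) (f : A -> B) : Prop :=
  [/\ linear f,
      {morph f : x y / x ** y} &
      {morph f : x / x^#}].

Definition cstar_subalgebra (R : realType) (A : cstarAlgType R)
    (S : set A) : Prop :=
  [/\ closed S, S 0,
      (forall (a : R[i]) (x y : A), S x -> S y -> S (a *: x + y)),
      (forall x y : A, S x -> S y -> S (x ** y)) &
      (forall x : A, S x -> S x^#)].

Definition cstar_generates (R : realType) (A : cstarAlgType R)
    (X : set A) : Prop :=
  forall S : set A, cstar_subalgebra S -> X `<=` S -> S = setT.

(* A category presented by its objects and its countable set of all morphisms.
   comp mu nu is the composite "mu after nu"; it is a total function whose
   value is unconstrained unless src mu = rng nu. *)
Record countableCategory := CountableCategory {
  obj : Type;
  mor :> countType;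
  rng : mor -> obj;
  src : mor -> obj;
  idm : obj -> mor;
  comp : mor -> mor -> mor;
  rng_idm : forall v, rng (idm v) = v;
  src_idm : forall v, src (idm v) = v;
  rng_comp : forall mu nu, src mu = rng nu -> rng (comp mu nu) = rng mu;
  src_comp : forall mu nu, src mu = rng nu -> src (comp mu nu) = src nu;
  comp_idl : forall mu, comp (idm (rng mu)) mu = mu;
  comp_idr : forall mu, comp mu (idm (src mu)) = mu;
  compA : forall la mu nu, src la = rng mu -> src mu = rng nu ->
    comp la (comp mu nu) = comp (comp la mu) nu
}.

(* N^k is {ffun 'I_k -> nat} with its pointwise monoid structure. *)
Record kGraph (k : nat) := KGraph {
  kg_cat :> countableCategory;
  kg_nonempty : inhabited (mor kg_cat);
  deg : kg_cat -> {ffun 'I_k -> nat};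
  deg_idm : forall v, deg (idm v) = 0;
  deg_comp : forall mu nu, src mu = rng nu ->
    deg (comp mu nu) = deg mu + deg nu;
  factorisation : forall (la : kg_cat) (m n : {ffun 'I_k -> nat}),
    deg la = m + n ->
    exists! p : kg_cat * kg_cat,
      [/\ deg p.1 = m, deg p.2 = n, src p.1 = rng p.2 & la = comp p.1 p.2]
}.

(* Lambda^0 = d^{-1}(0) consists exactly of the identity morphisms. *)
Lemma deg0_idm (k : nat) (L : kGraph k) (la : L) :
  deg la = 0 <-> exists v, la = idm v.
Proof.
split=> [la0|[v ->]]; last exact: deg_idm.
have /factorisation[p [_ pU]] : deg la = 0 + 0 by rewrite addr0.
exists (src la).
have e1 : p = (la, idm (src la)).
  by apply: pU; rewrite /= deg_idm rng_idm comp_idr.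
have e2 : p = (idm (rng la), la).
  by apply: pU; rewrite /= deg_idm src_idm comp_idl.
by have [] : (la, idm (src la)) = (idm (rng la), la) by rewrite -e1 -e2.
Qed.

(* The set v Lambda^n. *)
Definition paths_to (k : nat) (L : kGraph k) (v : obj L)
    (n : {ffun 'I_k -> nat}) : set L :=
  [set la : L | rng la = v /\ deg la = n].

Definition row_finite (k : nat) (L : kGraph k) : Prop :=
  forall (v : obj L) (n : {ffun 'I_k -> nat}), finite_set (paths_to v n).

Definition no_sources (k : nat) (L : kGraph k) : Prop :=
  forall (v : obj L) (n : {ffun 'I_k -> nat}), paths_to v n !=set0.

(* Membership in Z^2(Lambda, T); only values of c on composable pairs are
   constrained (and used), so c stands for a function on Lambda^{*2}. *)
Definition twisting_cocycle (R : realType) (k : nat) (L : kGraph k)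
    (c : L -> L -> R[i]) : Prop :=
  [/\ (forall mu nu : L, src mu = rng nu -> `|c mu nu| = 1),
      (forall mu nu : L, src mu = rng nu ->
         deg mu = 0 \/ deg nu = 0 -> c mu nu = 1) &
      (forall la mu nu : L, src la = rng mu -> src mu = rng nu ->
         c la mu * c (comp la mu) nu = c mu nu * c la (comp mu nu))].

(* t_v is t (idm v).  The sum in the last clause is a finite-support sum, hence
   the ordinary finite sum when L is row-finite. *)
Definition CK_family (R : realType) (k : nat) (L : kGraph k)
    (c : L -> L -> R[i]) (B : cstarAlgType R) (t : L -> B) : Prop :=
  [/\ (forall v : obj L,
         t (idm v) ** t (idm v) = t (idm v) /\ (t (idm v))^# = t (idm v)) /\
      (forall v w : obj L, v <> w -> t (idm v) ** t (idm w) = 0),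
      (forall mu nu : L, src mu = rng nu ->
         t mu ** t nu = c mu nu *: t (comp mu nu)),
      (forall la : L, (t la)^# ** t la = t (idm (src la))) &
      (forall (v : obj L) (n : {ffun 'I_k -> nat}),
         t (idm v) = \sum_(la \in paths_to v n) (t la ** (t la)^#))].

(* (A, s) is C*(Lambda, c) with its universal generating family.  Uniqueness of
   the homomorphism f follows from generation. *)
Definition universal_CK_family (R : realType) (k : nat) (L : kGraph k)
    (c : L -> L -> R[i]) (A : cstarAlgType R) (s : L -> A) : Prop :=
  [/\ CK_family c s,
      cstar_generates (range s) &
      forall (B : cstarAlgType R) (t : L -> B), CK_family c t ->
        exists f : A -> B, star_hom f /\ forall la : L, f (s la) = t la].

(* Main.v *)
From HB Require Import structures.
Require Import Defs.
From mathcomp Require Import all_boot all_order all_algebra.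
From mathcomp Require Import all_classical all_reals all_analysis.
From mathcomp Require Import complex.
From mathcomp Require Import ring lra.

(** Why the theorem is true.  If s la = 0, then every Cuntz-Krieger
    (Lambda, c)-family t satisfies t (la) = 0, hence also
    t_v = t (la)^* t (la) = 0 for v = src la.  So it suffices to exhibit, for
    each object v, one Cuntz-Krieger family on one Hilbert space with t_v <> 0.

    As there are no sources, there is an infinite path alpha 0, alpha 1, ...
    starting at v, all of whose segments have positive degree in every
    coordinate.  Without the twist, Lambda would act on the germs of paths
    along it: the direct limit of the sets of paths mu ending at the vertex
    rng (alpha j), under the injections mu |-> mu alpha_j.  With the twist one
    takes instead the direct limit of the Hilbert spaces on these sets, under
    the isometries e_mu |-> c(mu, alpha_j) e_(mu alpha_j).  The operators
    e_mu |-> c(la, mu) e_(la mu) commute with these isometries precisely by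
    the cocycle identity, so they pass to the limit, and the same identity
    gives t_la t_mu = c(la, mu) t_(la mu).  The last Cuntz-Krieger relation,
    which can fail at a finite stage, holds in the limit: a germ is
    represented by arbitrarily long paths, and these have an initial segment
    of any prescribed degree, unique by factorisation (has_range_path,
    path_uniq).

    Concretely a germ is named by its shortest representative (germ), and
    phase records the scalar between a path and that representative; this
    realises the direct limit inside l2 over the natural numbers.  There each
    operator sends a basis vector to a unimodular multiple of a basis vector,
    injectively where it is not zero; winj isolates this situation, and its
    adjoint is obtained by reversing the arrows and conjugating the weights
    (wfun_adj).

    The target C*-algebra consists of all bounded operators on a Hilbert space;
    it is complete since operator-norm limits converge pointwise together with
    their adjoints (bop_cauchy_cvg). *)

Set Implicit Arguments.
Unset Strict Implicit.
Unset Printing Implicit Defensive.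

Import Order.TTheory GRing.Theory Num.Theory.
(* So that comp means composition in a category, not of functions. *)
Import Defs.
Import numFieldNormedType.Exports.
Import Normc.

Local Open Scope classical_set_scope.
Local Open Scope complex_scope.
Local Open Scope ring_scope.

(** * Bounded operators on a Hilbert space *)

(** A complex Hilbert space, given by the real part rdot of its inner product.
    The full inner product is rdot x y + i rdot x (i y), and a complex-linear
    map has the same adjoint for both; the real part spares complex-valued
    series when such a space is constructed.  Completeness is for Cauchy
    sequences, measured with the square of the norm. *)
HB.mixin Record Lmodule_isHilbert (R : realType) H
    of GRing.Lmodule R[i] H := {
  rdot : H -> H -> R;
  rdotC : forall x y, rdot x y = rdot y x;
  rdotDl : forall x y z, rdot (x + y) z = rdot x z + rdot y z;
  rdotZl : forall (r : R) x y, rdot (r%:C *: x) y = r * rdot x y;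
  rdot_conj : forall (a : R[i]) x y,
    rdot (a *: x) y = rdot x (Num.conj a *: y);
  rdot_ge0 : forall x, 0 <= rdot x x;
  rdot_eq0 : forall x, rdot x x = 0 -> x = 0;
  rdot_complete : forall u : nat -> H,
    (forall e : R, 0 < e -> exists N, forall m n, (N <= m)%N -> (N <= n)%N ->
       rdot (u m - u n) (u m - u n) <= e) ->
    exists x, forall e : R, 0 < e -> exists N, forall n, (N <= n)%N ->
       rdot (u n - x) (u n - x) <= e
}.

#[short(type="hilbertType")]
HB.structure Definition Hilbert (R : realType) :=
  {H of Lmodule_isHilbert R H & GRing.Lmodule R[i] H}.

Lemma conj_sqr_normc (R : realType) (a : R[i]) :
  Num.conj a * a = (normc a ^+ 2)%:C.
Proof. by rewrite mulrC -normCK rmorphXn. Qed.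

Lemma normc_real (R : realType) (a : R[i]) : `|a| = (normc a)%:C.
Proof. by []. Qed.

Lemma normc_ge0 (R : realType) (a : R[i]) : 0 <= normc a.
Proof. by rewrite -ler0c -normc_real normr_ge0. Qed.

(** The rates of convergence below are all of the form K / (n + 1); an
    inequality between limits is obtained by letting n grow. *)
Lemma ler_of_inv (R : realType) (a b K : R) :
  (forall n : nat, a <= b + K * n.+1%:R^-1) -> a <= b.
Proof.
move=> h; apply/ler_addgt0Pr => e e0.
have [K0|K0] := leP K 0.
  apply: (le_trans (h 0)); rewrite lerD2l invr1 mulr1; lra.
pose n := Num.truncn (K / e).
apply: (le_trans (h n)); rewrite lerD2l ler_pdivrMr//.
have := truncnS_gt (K / e).
by rewrite -/n ltr_pdivrMr// mulrC => /ltW.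
Qed.

Section hilbert.
Variables (R : realType) (H : hilbertType R).
Implicit Types x y z : H.

Lemma rdotDr x y z : rdot z (x + y) = rdot z x + rdot z y.
Proof. by rewrite rdotC rdotDl !(rdotC z). Qed.

Lemma rdotZr (r : R) x y : rdot x (r%:C *: y) = r * rdot x y.
Proof. by rewrite rdotC rdotZl rdotC. Qed.

Lemma rdotNl x y : rdot (- x) y = - rdot x y.
Proof.
have -> : - x = (-1)%:C *: x by rewrite rmorphN1 scaleN1r.
by rewrite rdotZl mulN1r.
Qed.

Lemma rdotNr x y : rdot x (- y) = - rdot x y.
Proof. by rewrite rdotC rdotNl rdotC. Qed.

Lemma rdot0l x : rdot 0 x = 0.
Proof. by have := rdotZl 0 0 x; rewrite scaler0 mul0r. Qed.

Lemma rdot_inj x y : (forall z, rdot x z = rdot y z) -> x = y.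
Proof.
move=> h; apply/eqP; rewrite -subr_eq0; apply/eqP/rdot_eq0.
by rewrite rdotDl rdotNl h subrr.
Qed.

Definition hnorm x : R := Num.sqrt (rdot x x).

Lemma hnorm_ge0 x : 0 <= hnorm x. Proof. exact: sqrtr_ge0. Qed.

Lemma sqr_hnorm x : hnorm x ^+ 2 = rdot x x.
Proof. by rewrite sqr_sqrtr// rdot_ge0. Qed.

Lemma hnorm_eq0 x : hnorm x = 0 -> x = 0.
Proof. by move=> h; apply: rdot_eq0; rewrite -sqr_hnorm h expr0n. Qed.

Lemma hnorm0 : hnorm 0 = 0.
Proof. by rewrite /hnorm rdot0l sqrtr0. Qed.

Lemma hnormZ (a : R[i]) x : hnorm (a *: x) = normc a * hnorm x.
Proof.
rewrite /hnorm rdot_conj scalerA conj_sqr_normc rdotZr sqrtrM ?sqr_ge0//.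
by rewrite sqrtr_sqr ger0_norm// normc_ge0.
Qed.

Lemma hnormN x : hnorm (- x) = hnorm x.
Proof. by rewrite /hnorm rdotNl rdotNr opprK. Qed.

Lemma hnorm_distC x y : hnorm (x - y) = hnorm (y - x).
Proof. by rewrite -hnormN opprB. Qed.

(** Cauchy-Schwarz, from the positivity of the square of |y| x - |x| y. *)
Lemma rdot_le x y : rdot x y <= hnorm x * hnorm y.
Proof.
have [x0|x0] := eqVneq (hnorm x) 0.
  by rewrite x0 mul0r (hnorm_eq0 x0) rdot0l.
have [y0|y0] := eqVneq (hnorm y) 0.
  by rewrite y0 mulr0 (hnorm_eq0 y0) rdotC rdot0l.
have xp : 0 < hnorm x by rewrite lt_neqAle eq_sym x0 hnorm_ge0.
have yp : 0 < hnorm y by rewrite lt_neqAle eq_sym y0 hnorm_ge0.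
have := rdot_ge0 ((hnorm y)%:C *: x - (hnorm x)%:C *: y).
rewrite rdotDl !rdotDr !rdotNl !rdotNr !rdotZl !rdotZr -!sqr_hnorm (rdotC y x).
have xy0 : 0 < hnorm x * hnorm y by rewrite mulr_gt0.
move: (rdot x y) (hnorm x) (hnorm y) xy0 => d p q pq h.
rewrite -(ler_pM2l pq); nra.
Qed.

Lemma rdot_abs_le x y : `|rdot x y| <= hnorm x * hnorm y.
Proof. by rewrite ler_norml rdot_le andbT lerNl -rdotNl -(hnormN x) rdot_le. Qed.

Lemma hnormD x y : hnorm (x + y) <= hnorm x + hnorm y.
Proof.
rewrite -ler_sqr ?nnegrE ?addr_ge0 ?hnorm_ge0//.
rewrite sqr_hnorm rdotDl !rdotDr (rdotC y x) sqrrD -!sqr_hnorm.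
have := rdot_le x y; lra.
Qed.

Lemma hnorm_triangle x y z : hnorm (x - z) <= hnorm (x - y) + hnorm (y - z).
Proof. by rewrite (le_trans _ (hnormD _ _))// addrA subrK. Qed.

Lemma hilbert_cvg_rate (u : nat -> H) (K : R) :
  (forall m n, hnorm (u m - u n) <= K * (m.+1%:R^-1 + n.+1%:R^-1)) ->
  exists x, forall n, hnorm (u n - x) <= K * n.+1%:R^-1.
Proof.
move=> uK.
have K0 : 0 <= K.
  by have := le_trans (hnorm_ge0 _) (uK 0 0); rewrite invr1 pmulr_lge0// ltr0Sn.
have tail (e : R) : 0 < e -> exists N : nat, forall n, (N <= n)%N ->
    K * n.+1%:R^-1 <= e.
  move=> e0; exists (Num.truncn (K / e)) => n Nn.
  rewrite ler_pdivrMr// mulrC -ler_pdivrMr//.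
  apply: ltW; apply: lt_le_trans (truncnS_gt _) _.
  by rewrite ler_nat ltnS.
have [e e0|x ux] := @rdot_complete R H u.
  have se0 : 0 < Num.sqrt e by rewrite sqrtr_gt0.
  have [N hN] := tail (Num.sqrt e / 2) (divr_gt0 se0 (ltr0Sn _ 1)).
  exists N => m n Nm Nn.
  rewrite -sqr_hnorm -(sqr_sqrtr (ltW e0)) ler_sqr ?nnegrE ?hnorm_ge0//.
  apply: (le_trans (uK m n)); rewrite mulrDr.
  by rewrite [leRHS]splitr lerD ?hN.
exists x => n; apply/ler_addgt0Pr => e e0.
have e20 : 0 < e / 2 by rewrite divr_gt0.
have [N hN] := tail _ e20.
have [M hM] := ux _ (exprn_gt0 2 e20).
pose m := maxn M N.
apply: (le_trans (hnorm_triangle _ (u m) _)).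
have h1 : hnorm (u m - x) <= e / 2.
  by rewrite -ler_sqr ?nnegrE ?hnorm_ge0 ?(ltW e20)// sqr_hnorm hM// leq_maxl.
rewrite (splitr e) addrA lerD// (le_trans (uK n m))// mulrDr lerD2l.
by rewrite hN// leq_maxr.
Qed.

(** Additivity of T follows from the existence of an adjoint (bfunD). *)
Definition adjoint_pair (T S : H -> H) : Prop :=
  [/\ (forall x y, rdot (T x) y = rdot x (S y)),
      (forall a x, T (a *: x) = a *: T x) &
      exists2 M : R, 0 <= M & forall x, hnorm (T x) <= M * hnorm x].

(** Because |S x|^2 = <T (S x), x>, which is at most M |S x| |x|. *)
Lemma adjoint_bound (T S : H -> H) (M : R) : 0 <= M ->
  (forall x y, rdot (T x) y = rdot x (S y)) ->
  (forall x, hnorm (T x) <= M * hnorm x) ->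
  forall x, hnorm (S x) <= M * hnorm x.
Proof.
move=> M0 adjTS TM x.
have [->|n0] := eqVneq (hnorm (S x)) 0; first by rewrite mulr_ge0 ?hnorm_ge0.
have np : 0 < hnorm (S x) by rewrite lt_neqAle eq_sym n0 hnorm_ge0.
rewrite -(ler_pM2l np) -expr2 sqr_hnorm -adjTS (le_trans (rdot_le _ _))//.
by rewrite mulrA ler_wpM2r ?hnorm_ge0// mulrC TM.
Qed.

Lemma adjoint_pair_adj T S : adjoint_pair T S -> adjoint_pair S T.
Proof.
case=> adjTS TZ [M M0 TM]; split.
- by move=> x y; rewrite rdotC -adjTS rdotC.
- move=> a x; apply: rdot_inj => z.
  by rewrite rdotC -adjTS rdotC !rdot_conj -TZ rdotC adjTS rdotC.
by exists M => //; exact: adjoint_bound adjTS TM.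
Qed.

Lemma adjoint_pair0 : adjoint_pair (fun=> 0) (fun=> 0).
Proof.
split; first by move=> x y; rewrite rdot0l rdotC rdot0l.
  by move=> a _; rewrite scaler0.
by exists 0 => // x; rewrite hnorm0 mul0r.
Qed.

Lemma adjoint_pairD T S T' S' : adjoint_pair T S -> adjoint_pair T' S' ->
  adjoint_pair (fun x => T x + T' x) (fun x => S x + S' x).
Proof.
case=> a1 z1 [M M0 TM] [a2 z2 [M' M0' TM']]; split.
- by move=> x y; rewrite rdotDl rdotDr a1 a2.
- by move=> a x; rewrite z1 z2 scalerDr.
exists (M + M'); first by rewrite addr_ge0.
by move=> x; rewrite (le_trans (hnormD _ _))// mulrDl lerD.
Qed.

Lemma adjoint_pairZ (a : R[i]) T S : adjoint_pair T S ->
  adjoint_pair (fun x => a *: T x) (fun x => Num.conj a *: S x).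
Proof.
case=> a1 z1 [M M0 TM]; split.
- move=> x y; rewrite rdot_conj a1; congr rdot.
  by have [_ -> _] := adjoint_pair_adj (And3 a1 z1 (ex_intro2 _ _ M M0 TM)).
- by move=> b x; rewrite z1 !scalerA mulrC.
exists (normc a * M); first by rewrite mulr_ge0// normc_ge0.
by move=> x; rewrite hnormZ -mulrA ler_wpM2l ?normc_ge0.
Qed.

Lemma adjoint_pair_comp T S T' S' : adjoint_pair T S -> adjoint_pair T' S' ->
  adjoint_pair (T \o T') (S' \o S).
Proof.
case=> a1 z1 [M M0 TM] [a2 z2 [M' M0' TM']]; split.
- by move=> x y /=; rewrite a1 a2.
- by move=> a x /=; rewrite z2 z1.
exists (M * M'); first by rewrite mulr_ge0.
by move=> x /=; rewrite (le_trans (TM _))// -mulrA ler_wpM2l.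
Qed.

(** Carrying the adjoint as data makes the involution a mere swap. *)
Record bop := Bop { bfun :> H -> H; badj : H -> H; bop_adjP : adjoint_pair bfun badj }.

(** The adjoint is determined by the operator, as rdot is nondegenerate. *)
Lemma bop_ext (T S : bop) : T =1 S -> T = S.
Proof.
case: T S => T T' hT [S S' hS] /= /funext TS; subst S.
have : T' = S'.
  apply/funext => x; apply: rdot_inj => z.
  by case: hT => h1 _ _; case: hS => h2 _ _; rewrite rdotC -h1 h2 rdotC.
by move=> TS'; subst S'; congr Bop; exact: Prop_irrelevance.
Qed.

Implicit Types T S U : bop.

HB.instance Definition _ := gen_eqMixin bop.
HB.instance Definition _ := gen_choiceMixin bop.

Definition bop0 := Bop adjoint_pair0.
Definition bopD (T S : bop) := Bop (adjoint_pairD (bop_adjP T) (bop_adjP S)).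
Definition bopZ a (T : bop) := Bop (adjoint_pairZ a (bop_adjP T)).
Definition bopN := bopZ (-1).
Definition bopM (T S : bop) := Bop (adjoint_pair_comp (bop_adjP T) (bop_adjP S)).
Definition bopA (T : bop) := Bop (adjoint_pair_adj (bop_adjP T)).

Lemma bopDA : associative bopD.
Proof. by move=> x y z; apply: bop_ext => u /=; rewrite addrA. Qed.
Lemma bopDC : commutative bopD.
Proof. by move=> x y; apply: bop_ext => u /=; rewrite addrC. Qed.
Lemma bop0D : left_id bop0 bopD.
Proof. by move=> x; apply: bop_ext => u /=; rewrite add0r. Qed.
Lemma bopND : left_inverse bop0 bopN bopD.
Proof. by move=> x; apply: bop_ext => u /=; rewrite scaleN1r addNr. Qed.

HB.instance Definition _ := GRing.isZmodule.Build bop bopDA bopDC bop0D bopND.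

Lemma bopZA a b T : bopZ a (bopZ b T) = bopZ (a * b) T.
Proof. by apply: bop_ext => u /=; rewrite scalerA. Qed.
Lemma bopZ1 : left_id 1 bopZ.
Proof. by move=> T; apply: bop_ext => u /=; rewrite scale1r. Qed.
Lemma bopZDr : right_distributive bopZ +%R.
Proof. by move=> a T S; apply: bop_ext => u /=; rewrite scalerDr. Qed.
Lemma bopZDl T : {morph bopZ^~ T : a b / a + b}.
Proof. by move=> a b; apply: bop_ext => u /=; rewrite scalerDl. Qed.

HB.instance Definition _ :=
  GRing.Zmodule_isLmodule.Build R[i] bop bopZA bopZ1 bopZDr bopZDl.

Lemma bopDE (T S : bop) x : (T + S) x = T x + S x. Proof. by []. Qed.
Lemma bopZE a (T : bop) x : (a *: T) x = a *: T x. Proof. by []. Qed.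
Lemma bopBE (T S : bop) x : (T - S) x = T x - S x.
Proof. by rewrite bopDE /= scaleN1r. Qed.

Lemma bfunD (T : bop) x y : T (x + y) = T x + T y.
Proof.
have [adjT _ _] := bop_adjP T.
by apply: rdot_inj => z; rewrite rdotDl !adjT rdotDl.
Qed.

Lemma rdot_bop (T : bop) x y : rdot (T x) y = rdot x (badj T y).
Proof. by case: (bop_adjP T). Qed.

Lemma bfunZ (T : bop) a x : T (a *: x) = a *: T x.
Proof. by case: (bop_adjP T). Qed.

Lemma bfun0 (T : bop) : T 0 = 0.
Proof. by rewrite -(scale0r 0) bfunZ !scale0r. Qed.

Let bounds (T : bop) :=
  [set M : R | 0 <= M /\ forall x, hnorm (T x) <= M * hnorm x].

Definition opnorm (T : bop) : R := inf (bounds T).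

Let bounds_neq0 T : bounds T !=set0.
Proof. by have [_ _ [M M0 hM]] := bop_adjP T; exists M. Qed.

Lemma opnorm_ge0 T : 0 <= opnorm T.
Proof. by apply: lb_le_inf => // M []. Qed.

Lemma opnormP T x : hnorm (T x) <= opnorm T * hnorm x.
Proof.
have [x0|x0] := eqVneq (hnorm x) 0.
  have [_ _ [M M0 hM]] := bop_adjP T.
  by have := hM x; rewrite x0 !mulr0.
have xp : 0 < hnorm x by rewrite lt_neqAle eq_sym x0 hnorm_ge0.
rewrite -ler_pdivrMr//; apply: lb_le_inf => // M [_ hM].
by rewrite ler_pdivrMr.
Qed.

Lemma opnorm_le T M : 0 <= M -> (forall x, hnorm (T x) <= M * hnorm x) ->
  opnorm T <= M.
Proof. by move=> M0 hM; apply: ge_inf => /=; [exists 0 => ? []|split]. Qed.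

Lemma opnormD T S : opnorm (T + S) <= opnorm T + opnorm S.
Proof.
apply: opnorm_le => [|x]; first by rewrite addr_ge0 ?opnorm_ge0.
by rewrite bopDE (le_trans (hnormD _ _))// mulrDl lerD ?opnormP.
Qed.

Lemma opnormZ_le a T : opnorm (a *: T) <= normc a * opnorm T.
Proof.
apply: opnorm_le => [|x]; first by rewrite mulr_ge0 ?opnorm_ge0 ?normc_ge0.
by rewrite bopZE hnormZ -mulrA ler_wpM2l ?normc_ge0 ?opnormP.
Qed.

Lemma opnormZ a T : opnorm (a *: T) = normc a * opnorm T.
Proof.
apply/eqP; rewrite eq_le opnormZ_le /=.
have [->|a0] := eqVneq a 0; first by rewrite normc0 mul0r opnorm_ge0.
have ap : 0 < normc a.
  rewrite lt_neqAle normc_ge0 andbT eq_sym; apply: contra_neq a0.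
  exact: eq0_normc.
have := opnormZ_le a^-1 (a *: T).
by rewrite scalerA mulVf// scale1r normcV ler_pdivlMl.
Qed.

(** The norm of a normed module over R[i] takes its values in R[i]. *)
Definition cnorm T : R[i] := (opnorm T)%:C.

Lemma cnormD T S : cnorm (T + S) <= cnorm T + cnorm S.
Proof. by rewrite -rmorphD lecR opnormD. Qed.

Lemma cnormZ (a : R[i]) T : cnorm (a *: T) = `|a| * cnorm T.
Proof. by rewrite normc_real -rmorphM -opnormZ. Qed.

Lemma cnorm_eq0 T : cnorm T = 0 -> T = 0.
Proof.
move=> /complexI T0; apply: bop_ext => x; apply: hnorm_eq0.
by apply/eqP; rewrite eq_le hnorm_ge0 andbT (le_trans (opnormP T x))// T0 mul0r.
Qed.

HB.instance Definition _ := Lmodule_isNormed.Build R[i] bop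
  cnormD cnormZ cnorm_eq0.

Lemma opnorm_dist_le (T S : bop) K : 0 <= K ->
  (forall x, hnorm (T x - S x) <= K * hnorm x) -> opnorm (T - S) <= K.
Proof. by move=> K0 h; apply: opnorm_le => // x; rewrite bopBE. Qed.

Lemma opnormA_le T : opnorm (bopA T) <= opnorm T.
Proof.
apply: opnorm_le; first exact: opnorm_ge0.
exact: adjoint_bound (opnorm_ge0 T) (rdot_bop T) (opnormP T).
Qed.

Lemma bopAK : involutive bopA. Proof. by move=> T; exact: bop_ext. Qed.

Lemma bopAD : {morph bopA : T S / T + S}.
Proof. by move=> T S; exact: bop_ext. Qed.

Lemma bopAZ a T : bopA (a *: T) = Num.conj a *: bopA T.
Proof. exact: bop_ext. Qed.

Lemma bopAB : {morph bopA : T S / T - S}.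
Proof.
by move=> T S; apply: bop_ext => x; rewrite bopAD bopBE bopDE /= rmorphN1 scaleN1r.
Qed.

(** At each vector a Cauchy sequence of operators converges, and so does the
    sequence of adjoints; the relation between an operator and its adjoint, and
    homogeneity, pass to the two pointwise limits. *)
Lemma bop_cauchy_cvg (T : nat -> bop) :
  (forall m n, opnorm (T m - T n) <= m.+1%:R^-1 + n.+1%:R^-1) ->
  exists S, forall n, opnorm (T n - S) <= n.+1%:R^-1.
Proof.
move=> Tc.
have lim (U : nat -> bop) :
    (forall m n, opnorm (U m - U n) <= m.+1%:R^-1 + n.+1%:R^-1) ->
    {S : H -> H & forall x n, hnorm (U n x - S x) <= hnorm x * n.+1%:R^-1}.
  move=> Uc; apply: (@choice _ _
    (fun x y => forall n, hnorm (U n x - y) <= hnorm x * n.+1%:R^-1)).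
  move=> x; apply: hilbert_cvg_rate => m n.
  by rewrite -bopBE (le_trans (opnormP _ _))// mulrC ler_wpM2l ?hnorm_ge0.
have [S hS] := lim T Tc.
have [m n|S' hS'] := lim (bopA \o T).
  by rewrite /= -bopAB (le_trans (opnormA_le _)).
have bS : adjoint_pair S S'.
  split.
  - move=> x y; apply/eqP; rewrite -subr_eq0 -normr_eq0 eq_le normr_ge0 andbT.
    apply: (@ler_of_inv _ _ _ (hnorm x * hnorm y *+ 2)) => n.
    rewrite add0r.
    have -> : rdot (S x) y - rdot x (S' y) =
        rdot (S x - T n x) y + rdot x (badj (T n) y - S' y).
      by rewrite rdotDl rdotDr rdotNl rdotNr rdot_bop addrA subrK.
    apply: (le_trans (ler_normD _ _)); rewrite mulrnAl mulr2n lerD//.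
      apply: (le_trans (rdot_abs_le _ _)).
      by rewrite mulrAC ler_wpM2r ?hnorm_ge0// hnorm_distC.
    apply: (le_trans (rdot_abs_le _ _)).
    by rewrite -mulrA ler_wpM2l ?hnorm_ge0// hS'.
  - move=> a x; apply/eqP; rewrite -subr_eq0; apply/eqP/hnorm_eq0/eqP.
    rewrite eq_le hnorm_ge0 andbT.
    apply: (@ler_of_inv _ _ _ (normc a * hnorm x *+ 2)) => n; rewrite add0r.
    apply: (le_trans (hnorm_triangle _ (T n (a *: x)) _)).
    rewrite mulrnAl mulr2n lerD//; first by rewrite hnorm_distC -hnormZ.
    by rewrite bfunZ -scalerBr hnormZ -mulrA ler_wpM2l ?normc_ge0.
  exists (opnorm (T 0) + 1); first by rewrite addr_ge0 ?opnorm_ge0.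
  move=> x; rewrite -(subrK (T 0 x) (S x)) (le_trans (hnormD _ _))//.
  rewrite mulrDl addrC lerD ?opnormP// mul1r hnorm_distC.
  by have := hS x 0; rewrite invr1 mulr1.
by exists (Bop bS) => n; apply: opnorm_dist_le => // x; rewrite mulrC hS.
Qed.

(** A Cauchy filter is reduced to a Cauchy sequence by choosing T n with the
    ball of radius 1 / (n + 1) around it in the filter. *)
Lemma bop_complete (F : set_system bop) : ProperFilter F -> cauchy F -> cvg F.
Proof.
move=> FF /cauchyP Fc.
have inv_gt0 (n : nat) : (0 : R[i]) < (n.+1%:R^-1 : R)%:C.
  by rewrite ltcR invr_gt0 ltr0n.
have [T FT] := choice (fun n : nat => Fc _ (inv_gt0 n)).
have ballE (T1 T2 : bop) (e : R) : ball T1 e%:C T2 <-> opnorm (T1 - T2) < e.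
  by rewrite -ball_normE /= /Num.norm /= /cnorm ltcR.
have [m n|S hS] := @bop_cauchy_cvg T.
  have [U [/ballE Um /ballE Un]] := filter_ex (filterI (FT m) (FT n)).
  have -> : T m - T n = (T m - U) + (U - T n) by rewrite addrA subrK.
  apply: (le_trans (opnormD _ _)); apply: lerD; first exact: ltW.
  have -> : U - T n = (-1) *: (T n - U) by rewrite scaleN1r opprB.
  by rewrite opnormZ normcN normc1 mul1r ltW.
apply/cvg_ex; exists S; apply/cvg_ballP => e e0.
have eE : e = (complex.Re e)%:C by rewrite RRe_real// gtr0_real.
have {}e0 : 0 < complex.Re e by move: e0; rewrite eE ltcR.
rewrite eE; set n := Num.truncn (2 / complex.Re e).
have hn : n.+1%:R^-1 + n.+1%:R^-1 <= complex.Re e.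
  have h : n.+1%:R^-1 <= complex.Re e / 2.
    rewrite -[leRHS]invrK lef_pV2 ?posrE ?ltr0n ?invr_gt0 ?divr_gt0//.
    by rewrite invf_div ltW// truncnS_gt.
  by rewrite [leRHS]splitr lerD.
apply: filterS (FT n) => U /ballE hU; apply/ballE.
have -> : S - U = (-1) *: (T n - S) + (T n - U).
  by rewrite scaleN1r opprB addrA subrK.
apply: (le_lt_trans (opnormD _ _)); rewrite opnormZ normcN normc1 mul1r.
by apply: lt_le_trans hn; apply: ler_ltD.
Qed.

HB.instance Definition _ := Uniform_isComplete.Build bop bop_complete.

Lemma bopMA : associative bopM. Proof. by move=> T S U; exact: bop_ext. Qed.
Lemma bopMDl : left_distributive bopM +%R.
Proof. by move=> T S U; exact: bop_ext. Qed.
Lemma bopMDr : right_distributive bopM +%R.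
Proof. by move=> T S U; apply: bop_ext => x /=; rewrite bfunD. Qed.
Lemma bopMZl a (T S : bop) : bopM (a *: T) S = a *: bopM T S.
Proof. exact: bop_ext. Qed.
Lemma bopMZr a (T S : bop) : bopM T (a *: S) = a *: bopM T S.
Proof. by apply: bop_ext => x /=; rewrite bfunZ. Qed.
Lemma bopAM T S : bopA (bopM T S) = bopM (bopA S) (bopA T).
Proof. exact: bop_ext. Qed.

Lemma opnormM T S : opnorm (bopM T S) <= opnorm T * opnorm S.
Proof.
apply: opnorm_le => [|x /=]; first by rewrite mulr_ge0 ?opnorm_ge0.
by rewrite (le_trans (opnormP _ _))// -mulrA ler_wpM2l ?opnorm_ge0 ?opnormP.
Qed.

(** The C*-identity rests on |T x|^2 = <x, T^* T x>. *)
Lemma opnorm_adjM T : opnorm (bopM (bopA T) T) = opnorm T ^+ 2.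
Proof.
apply/eqP; rewrite eq_le; apply/andP; split.
  by rewrite (le_trans (opnormM _ _))// expr2 ler_wpM2r ?opnorm_ge0 ?opnormA_le.
set N := opnorm (bopM _ _).
have N0 : 0 <= N by exact: opnorm_ge0.
rewrite -(sqr_sqrtr N0) ler_sqr ?nnegrE ?opnorm_ge0 ?sqrtr_ge0//.
apply: opnorm_le => [|x]; first exact: sqrtr_ge0.
rewrite -ler_sqr ?nnegrE ?mulr_ge0 ?hnorm_ge0 ?sqrtr_ge0//.
rewrite exprMn (sqr_sqrtr N0) [leLHS]sqr_hnorm rdot_bop.
rewrite (le_trans (rdot_le _ _))// expr2 mulrA mulrC ler_wpM2r ?hnorm_ge0//.
exact: (opnormP (bopM (bopA T) T) x).
Qed.

Lemma cnormM_bop (T S : bop) : `|bopM T S| <= `|T| * `|S|.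
Proof. by rewrite /Num.norm /= /cnorm -rmorphM lecR opnormM. Qed.

Lemma cnorm_adjM_bop (T : bop) : `|bopM (bopA T) T| = `|T| ^+ 2.
Proof. by rewrite /Num.norm /= /cnorm -rmorphXn -opnorm_adjM. Qed.

HB.instance Definition _ := isCStarAlgebra.Build R bop
  bopMA bopMDl bopMDr bopMZl bopMZr bopAK bopAD bopAZ bopAM
  cnormM_bop cnorm_adjM_bop.

End hilbert.

(** * Square-summable sequences and weighted partial injections *)

Section square_summable.
Variable R : realType.
Implicit Types (z w : R[i]) (i j N : nat).

Definition rdotc z w : R :=
  complex.Re z * complex.Re w + complex.Im z * complex.Im w.

Definition sqc z := rdotc z z.

Lemma rdotcC z w : rdotc z w = rdotc w z.
Proof. by rewrite /rdotc mulrC (mulrC (complex.Im _)). Qed.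

Lemma rdotcDl z z' w : rdotc (z + z') w = rdotc z w + rdotc z' w.
Proof. by case: z z' => a b [c d]; rewrite /rdotc /=; ring. Qed.

Lemma rdotcZl (r : R) z w : rdotc (r%:C * z) w = r * rdotc z w.
Proof. by case: z => a b; rewrite /rdotc /=; ring. Qed.

Lemma rdotc_conj (a : R[i]) z w : rdotc (a * z) w = rdotc z (Num.conj a * w).
Proof. by case: a z w => a b [p q] [s t]; rewrite /rdotc /=; ring. Qed.

Lemma rdotc0l w : rdotc 0 w = 0.
Proof. by rewrite /rdotc !mul0r addr0. Qed.

Lemma sqc_ge0 z : 0 <= sqc z.
Proof. by rewrite addr_ge0// -expr2 sqr_ge0. Qed.

Lemma sqc_eq0 z : sqc z = 0 -> z = 0.
Proof.
case: z => a b /eqP; rewrite /sqc /rdotc -!expr2 paddr_eq0 ?sqr_ge0//=.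
by rewrite !sqrf_eq0 => /andP[/eqP -> /eqP ->].
Qed.

Lemma sqcM z w : sqc (z * w) = sqc z * sqc w.
Proof. by case: z w => a b [c d]; rewrite /sqc /rdotc /=; ring. Qed.

Lemma sqc_norm1 z : `|z| = 1 -> sqc z = 1.
Proof.
move=> z1; apply: (@complexI R).
by rewrite /sqc /rdotc -!expr2 add_Re2_Im2 z1 expr1n.
Qed.

Lemma rdotc_abs_le z w : `|rdotc z w| <= sqc z + sqc w.
Proof.
case: z w => a b [c d]; rewrite /sqc /rdotc /= ler_norml.
have := sqr_ge0 (a + c); have := sqr_ge0 (a - c).
have := sqr_ge0 (b + d); have := sqr_ge0 (b - d).
have := sqr_ge0 a; have := sqr_ge0 b; have := sqr_ge0 c; have := sqr_ge0 d.
by move=> *; apply/andP; split; nra.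
Qed.

Lemma sqcD_le z w : sqc (z + w) <= 2 * (sqc z + sqc w).
Proof.
case: z w => a b [c d]; rewrite /sqc /rdotc /=.
by have := sqr_ge0 (a - c); have := sqr_ge0 (b - d); nra.
Qed.

Definition square_summable (x : nat -> R[i]) : Prop :=
  exists M, forall N, \sum_(0 <= i < N) sqc (x i) <= M.

Lemma series_sqc_nd (x : nat -> R[i]) :
  nondecreasing_seq (series (fun i => sqc (x i))).
Proof. by apply: nondecreasing_series => i _ _; exact: sqc_ge0. Qed.

Lemma square_summable_cvg (x : nat -> R[i]) :
  square_summable x -> cvgn (series (fun i => sqc (x i))).
Proof.
case=> M xM; apply: nondecreasing_is_cvgn; first exact: series_sqc_nd.
by exists M => _ [N _ <-]; exact: xM.
Qed.

Lemma square_summable0 : square_summable (fun=> 0).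
Proof. by exists 0 => N; rewrite big1// => i _; rewrite /sqc rdotc0l. Qed.

Lemma square_summableD x y : square_summable x -> square_summable y ->
  square_summable (fun i => x i + y i).
Proof.
case=> M xM [M' yM]; exists (2 * (M + M')) => N.
apply: (@le_trans _ _ (\sum_(0 <= i < N) 2 * (sqc (x i) + sqc (y i)))).
  by apply: ler_sum => i _; exact: sqcD_le.
by rewrite -mulr_sumr big_split/= ler_wpM2l// lerD.
Qed.

Lemma square_summableZ a x : square_summable x ->
  square_summable (fun i => a * x i).
Proof.
case=> M xM; exists (sqc a * M) => N.
under eq_bigr do rewrite sqcM.
by rewrite -mulr_sumr ler_wpM2l// sqc_ge0.
Qed.

Record l2 := L2 { l2fun :> nat -> R[i]; l2P : square_summable l2fun }.
Implicit Types x y : l2.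

Lemma l2_ext x y : x =1 y -> x = y.
Proof.
case: x y => x hx [y hy] /= /funext xy; subst y.
by congr L2; exact: Prop_irrelevance.
Qed.

HB.instance Definition _ := gen_eqMixin l2.
HB.instance Definition _ := gen_choiceMixin l2.

Definition l2_0 := L2 square_summable0.
Definition l2D x y := L2 (square_summableD (l2P x) (l2P y)).
Definition l2Z a x := L2 (square_summableZ a (l2P x)).
Definition l2N := l2Z (-1).

Lemma l2DA : associative l2D.
Proof. by move=> x y z; apply: l2_ext => i /=; rewrite addrA. Qed.
Lemma l2DC : commutative l2D.
Proof. by move=> x y; apply: l2_ext => i /=; rewrite addrC. Qed.
Lemma l2_0D : left_id l2_0 l2D.
Proof. by move=> x; apply: l2_ext => i /=; rewrite add0r. Qed.
Lemma l2ND : left_inverse l2_0 l2N l2D.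
Proof. by move=> x; apply: l2_ext => i /=; rewrite mulN1r addNr. Qed.

HB.instance Definition _ := GRing.isZmodule.Build l2 l2DA l2DC l2_0D l2ND.

Lemma l2ZA a b x : l2Z a (l2Z b x) = l2Z (a * b) x.
Proof. by apply: l2_ext => i /=; rewrite mulrA. Qed.
Lemma l2Z1 : left_id 1 l2Z.
Proof. by move=> x; apply: l2_ext => i /=; rewrite mul1r. Qed.
Lemma l2ZDr : right_distributive l2Z +%R.
Proof. by move=> a x y; apply: l2_ext => i /=; rewrite mulrDr. Qed.
Lemma l2ZDl x : {morph l2Z^~ x : a b / a + b}.
Proof. by move=> a b; apply: l2_ext => i /=; rewrite mulrDl. Qed.

HB.instance Definition _ :=
  GRing.Zmodule_isLmodule.Build R[i] l2 l2ZA l2Z1 l2ZDr l2ZDl.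

Lemma l2DE x y i : (x + y) i = x i + y i. Proof. by []. Qed.

Lemma l2ZE (a : R[i]) x i : (a *: x) i = a * x i. Proof. by []. Qed.

Lemma l2BE x y i : (x - y) i = x i - y i.
Proof. by rewrite /= mulN1r. Qed.

Definition l2dot x y : R := limn (series (fun i => rdotc (x i) (y i))).

Lemma cvg_l2dot x y : cvgn (series (fun i => rdotc (x i) (y i))).
Proof.
apply: normed_cvg; apply: (series_le_cvg (v_ := (sqc \o x) + (sqc \o y))).
- by move=> i; exact: normr_ge0.
- by move=> i; rewrite addr_ge0 ?sqc_ge0.
- by move=> i; exact: rdotc_abs_le.
by apply: is_cvg_seriesD; apply: square_summable_cvg; exact: l2P.
Qed.

Arguments cvg_l2dot : clear implicits.

Lemma l2dot_ext x y x' y' :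
  (forall i, rdotc (x i) (y i) = rdotc (x' i) (y' i)) ->
  l2dot x y = l2dot x' y'.
Proof. by move=> /funext h; rewrite /l2dot h. Qed.

Lemma l2dotC x y : l2dot x y = l2dot y x.
Proof. by apply: l2dot_ext => i; exact: rdotcC. Qed.

Lemma l2dotDl x y (z : l2) : l2dot (x + y) z = l2dot x z + l2dot y z.
Proof.
rewrite /l2dot -lim_seriesD; try exact: cvg_l2dot.
by congr (limn (series _)); apply/funext => i; exact: rdotcDl.
Qed.

Lemma l2dotZl (r : R) x y : l2dot (r%:C *: x) y = r * l2dot x y.
Proof.
rewrite /l2dot -[RHS](lim_seriesZ _ (cvg_l2dot x y)).
by congr (limn (series _)); apply/funext => i; exact: rdotcZl.
Qed.

Lemma l2dot_conj (a : R[i]) x y :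
  l2dot (a *: x) y = l2dot x (Num.conj a *: y).
Proof. by apply: l2dot_ext => i; exact: rdotc_conj. Qed.

Lemma sum_sqc_le x N : \sum_(0 <= i < N) sqc (x i) <= l2dot x x.
Proof. exact: (nondecreasing_cvgn_le (@series_sqc_nd x) (cvg_l2dot x x)). Qed.

Lemma l2dot_le x M : (forall N, \sum_(0 <= i < N) sqc (x i) <= M) ->
  l2dot x x <= M.
Proof. by move=> h; apply: limr_le; [exact: cvg_l2dot|exact: nearW]. Qed.

(** Sums over arbitrary finite sets of indices, as a partial injection
    scrambles the initial segments that define l2dot. *)
Lemma sum_uniq_sqc_le x (s : seq nat) : uniq s ->
  \sum_(i <- s) sqc (x i) <= l2dot x x.
Proof.
move=> us; apply: le_trans (sum_sqc_le x (\max_(i <- s) i).+1).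
rewrite [leRHS](bigID (mem s))/= -[leLHS]addr0 lerD//; last first.
  by apply: sumr_ge0 => i _; exact: sqc_ge0.
rewrite -[leRHS]big_filter le_eqVlt; apply/orP; left; apply/eqP.
apply: perm_big.
apply: uniq_perm => //; first by rewrite filter_uniq// iota_uniq.
move=> i; rewrite mem_filter mem_index_iota /=.
by case: (boolP (i \in s)) => //= si; rewrite ltnS; apply/esym/leq_bigmax_seq.
Qed.

Lemma l2dot_ge0 x : 0 <= l2dot x x.
Proof. by have := sum_sqc_le x 0; rewrite big_geq. Qed.

Lemma sqc_le_l2dot x i : sqc (x i) <= l2dot x x.
Proof. by have := @sum_uniq_sqc_le x [:: i] isT; rewrite big_seq1. Qed.

Lemma l2dot_eq0 x : l2dot x x = 0 -> x = 0.
Proof.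
move=> x0; apply: l2_ext => i; apply: sqc_eq0.
by apply/eqP; rewrite eq_le sqc_ge0 -x0 sqc_le_l2dot.
Qed.

Lemma cauchy_seq_cvg (f : nat -> R) :
  (forall e : R, 0 < e -> exists N, forall m n, (N <= m)%N -> (N <= n)%N ->
     (f m - f n) ^+ 2 <= e) -> cvgn f.
Proof.
move=> fc; apply/cauchy_cvgP/cauchyP => e e0.
have e20 : 0 < e / 2 by rewrite divr_gt0.
have [N hN] := fc _ (exprn_gt0 2 e20).
exists (f N); exists N => // n /= Nn.
apply: (@le_lt_trans _ _ (e / 2)); last by rewrite ltr_pdivrMr// ltr_pMr// ltr1n.
by rewrite -ler_sqr ?nnegrE ?(ltW e20)// real_normK ?num_real// hN.
Qed.

(** The candidate limit is the coordinatewise one.  A bound on the finite sums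
    of |u n i - u m i|^2 that is uniform in m survives the limit over m, so the
    convergence is in norm. *)
Lemma l2_complete (u : nat -> l2) :
  (forall e : R, 0 < e -> exists N, forall m n, (N <= m)%N -> (N <= n)%N ->
     l2dot (u m - u n) (u m - u n) <= e) ->
  exists x, forall e : R, 0 < e -> exists N, forall n, (N <= n)%N ->
     l2dot (u n - x) (u n - x) <= e.
Proof.
move=> uc.
have sqcE z w : sqc (z - w) = (complex.Re z - complex.Re w) ^+ 2 +
    (complex.Im z - complex.Im w) ^+ 2 by case: z w => ? ? [].
have cRe i : cvgn (fun n => complex.Re (u n i)).
  apply: cauchy_seq_cvg => e /uc[N hN]; exists N => m n Nm Nn.
  apply: le_trans (hN m n Nm Nn); apply: le_trans (sqc_le_l2dot _ i).
  by rewrite l2BE sqcE lerDl sqr_ge0.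
have cIm i : cvgn (fun n => complex.Im (u n i)).
  apply: cauchy_seq_cvg => e /uc[N hN]; exists N => m n Nm Nn.
  apply: le_trans (hN m n Nm Nn); apply: le_trans (sqc_le_l2dot _ i).
  by rewrite l2BE sqcE lerDr sqr_ge0.
pose x i := limn (fun n => complex.Re (u n i)) +i*
            limn (fun n => complex.Im (u n i)).
have bound (e : R) N : (forall m n, (N <= m)%N -> (N <= n)%N ->
      l2dot (u m - u n) (u m - u n) <= e) ->
    forall n, (N <= n)%N -> forall K, \sum_(0 <= i < K) sqc (u n i - x i) <= e.
  move=> h n Nn K.
  have c : \sum_(0 <= i < K) sqc (u n i - u m i) @[m --> \oo] -->
      \sum_(0 <= i < K) sqc (u n i - x i).
    apply: cvg_big => [|i _]; first exact: add_continuous.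
    under eq_fun do rewrite sqcE; rewrite sqcE.
    by apply: cvgD; rewrite expr2; under eq_fun do rewrite expr2;
      apply: cvgM; apply: cvgB; (try exact: cvg_cst); [exact: cRe|exact: cRe
        |exact: cIm|exact: cIm].
  rewrite -(cvg_lim _ c)//; apply: limr_le; first by apply/cvg_ex; eexists; exact: c.
  exists N => // m /= Nm; apply: le_trans (h n m Nn Nm).
  by under eq_bigr do rewrite -l2BE; exact: sum_sqc_le.
have [N0 hN0] := uc 1 ltr01.
have xs : square_summable x.
  have ds : square_summable (fun i => u N0 i - x i).
    by exists 1; exact: (bound _ _ hN0).
  have := square_summableD (square_summableZ (-1) ds) (l2P (u N0)).
  by congr square_summable; apply/funext => i; rewrite mulN1r opprB subrK.
exists (L2 xs) => e /uc[N hN]; exists N => n Nn; apply: l2dot_le => K.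
by under eq_bigr do rewrite l2BE; exact: (bound _ _ hN).
Qed.

HB.instance Definition _ := Lmodule_isHilbert.Build R l2
  l2dotC l2dotDl l2dotZl l2dot_conj l2dot_ge0 l2dot_eq0 l2_complete.

(** Weighted partial injections: r i j w is meant as the rule e_i |-> w e_j
    between basis vectors, with e_i sent to 0 when no rule applies to i. *)
Definition winj (r : nat -> nat -> R[i] -> Prop) : Prop :=
  [/\ (forall i j j' w w', r i j w -> r i j' w' -> j = j' /\ w = w'),
      (forall i i' j w w', r i j w -> r i' j w' -> i = i') &
      (forall i j w, r i j w -> `|w| = 1)].

Lemma winj_norm1 r i j w : winj r -> r i j w -> `|w| = 1.
Proof. by case=> _ _ h /h. Qed.

(** Reversing the arrows and conjugating the weights gives the adjoint. *)
Definition wconv (r : nat -> nat -> R[i] -> Prop) i j w : Prop :=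
  r j i (Num.conj w).

Lemma winj_conv r : winj r -> winj (wconv r).
Proof.
case=> r1 r2 r3; split; rewrite /wconv.
- move=> i j j' w w' h h'; have e := r2 _ _ _ _ _ h h'; subst j'; split=> //.
  by have [_ /(can_inj conjCK)] := r1 _ _ _ _ _ h h'.
- by move=> i i' j w w' h h'; have [] := r1 _ _ _ _ _ h h'.
- by move=> i j w /r3; rewrite norm_conjC.
Qed.

Lemma wconvK r : wconv (wconv r) = r.
Proof.
by apply/funext => i; apply/funext => j; apply/funext => w; rewrite /wconv conjCK.
Qed.

Definition wsource r j : option (nat * R[i]) :=
  if pselect (exists p : nat * R[i], r p.1 j p.2) is left e
  then Some (projT1 (cid e)) else None.

Lemma wsourceP r i j w : winj r -> r i j w -> wsource r j = Some (i, w).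
Proof.
case=> r1 r2 _ h; rewrite /wsource; case: pselect => [e|[]]; last by exists (i, w).
case: (cid e) => -[i' w'] /= h'; have ? := r2 _ _ _ _ _ h h'; subst i'.
by have [_ ->] := r1 _ _ _ _ _ h h'.
Qed.

Lemma wsource_some r i j w : wsource r j = Some (i, w) -> r i j w.
Proof. by rewrite /wsource; case: pselect => // e; case: cid => -[? ?] /= h [<- <-]. Qed.

Definition wapp r (x : nat -> R[i]) j : R[i] :=
  if wsource r j is Some (i, w) then w * x i else 0.

(** Up to unimodular factors, the coordinates of wapp r x that do not vanish
    are coordinates of x, each occurring once. *)
Lemma sum_wapp_le r (x : l2) N : winj r ->
  \sum_(0 <= j < N) sqc (wapp r x j) <= l2dot x x.
Proof.
move=> hr; pose f j := omap fst (wsource r j).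
pose g i := if wsource (wconv r) i is Some p then p.1 else 0%N.
have fg : ocancel f g.
  rewrite /f /g => j; case E : (wsource r j) => [[i w]|//] /=.
  have h := wsource_some E.
  by rewrite (@wsourceP _ j i (Num.conj w))//; [exact: winj_conv|rewrite /wconv conjCK].
apply: le_trans (sum_uniq_sqc_le x (pmap_uniq fg (iota_uniq 0 N))).
rewrite big_pmap /index_iota subn0 le_eqVlt; apply/orP; left; apply/eqP.
apply: eq_bigr => j _; rewrite /wapp /f.
case E : (wsource r j) => [[i w]|] /=; last by rewrite /sqc rdotc0l.
by rewrite sqcM sqc_norm1 ?mul1r//; exact: winj_norm1 hr (wsource_some E).
Qed.

Lemma square_summable_wapp r (x : l2) : winj r -> square_summable (wapp r x).
Proof. by move=> hr; exists (l2dot x x) => N; exact: sum_wapp_le. Qed.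

Definition wfun r (hr : winj r) x : l2 := L2 (square_summable_wapp x hr).

Lemma wfunE r (hr : winj r) x i j w : r i j w -> wfun hr x j = w * x i.
Proof. by move=> h; rewrite /= /wapp (wsourceP hr h). Qed.

Lemma wfun0 r (hr : winj r) x j : (forall i w, ~ r i j w) -> wfun hr x j = 0.
Proof.
move=> h; rewrite /= /wapp; case E : (wsource r j) => [[i w]|//].
by case: (h i w); exact: wsource_some.
Qed.

Lemma wfun_case r (hr : winj r) j :
  (exists i w, r i j w) \/ (forall x, wfun hr x j = 0).
Proof.
have [|h] := pselect (exists i w, r i j w); [by left|right=> x].
by apply: wfun0 => i w hw; apply: h; exists i, w.
Qed.

Lemma wfunD r (hr : winj r) x y : wfun hr (x + y) = wfun hr x + wfun hr y.
Proof.
apply: l2_ext => j; have [[i [w h]]|h0] := wfun_case hr j.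
  by rewrite l2DE !(wfunE hr _ h) l2DE mulrDr.
by rewrite l2DE !h0 addr0.
Qed.

Lemma wfunZ r (hr : winj r) (a : R[i]) x : wfun hr (a *: x) = a *: wfun hr x.
Proof.
apply: l2_ext => j; have [[i [w h]]|h0] := wfun_case hr j.
  by rewrite l2ZE !(wfunE hr _ h) l2ZE mulrCA.
by rewrite l2ZE !h0 mulr0.
Qed.

Lemma conj_mul1 z : `|z| = 1 -> Num.conj z * z = 1.
Proof. by move=> z1; rewrite mulrC -normCK z1 expr1n. Qed.

(** The operator T of r and the operator S of its converse satisfy T S T = T:
    S T is the projection onto the domain of r. *)
Lemma wfunK r (hr : winj r) x : 
  wfun hr (wfun (winj_conv hr) (wfun hr x)) = wfun hr x.
Proof.
apply: l2_ext => j; have [[i [w h]]|h0] := wfun_case hr j; last by rewrite !h0.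
have hc : wconv r j i (Num.conj w) by rewrite /wconv conjCK.
rewrite !(wfunE hr _ h) (wfunE (winj_conv hr) _ hc) (wfunE hr _ h).
by rewrite !mulrA (mulrC w) conj_mul1 ?mul1r//; exact: winj_norm1 hr h.
Qed.

(** By T S T = T and contractivity, T x and S T x have the same norm;
    polarization upgrades this to inner products.  This replaces a
    rearrangement of the series defining l2dot. *)
Lemma wfun_dot r (hr : winj r) x y :
  l2dot (wfun hr x) (wfun hr y) =
  l2dot (wfun (winj_conv hr) (wfun hr x)) (wfun (winj_conv hr) (wfun hr y)).
Proof.
set T := wfun hr; set S := wfun _.
have le (q : nat -> nat -> R[i] -> Prop) (hq : winj q) (z : l2) :
    l2dot (wfun hq z) (wfun hq z) <= l2dot z z.
  by apply: l2dot_le => N; exact: sum_wapp_le.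
have eqn (z : l2) : l2dot (T z) (T z) = l2dot (S (T z)) (S (T z)).
  have TST : T (S (T z)) = T z := wfunK hr z.
  by apply/eqP; rewrite eq_le -{1 2}TST !le.
have := eqn (x + y).
rewrite /T /S !wfunD -/T -/S !l2dotDl !(l2dotC _ (_ + _)) !l2dotDl !eqn.
rewrite (l2dotC (T y) (T x)) (l2dotC (S (T y)) (S (T x))).
move: (l2dot _ _) (l2dot _ _) (l2dot _ _) (l2dot _ _) => a b c d; lra.
Qed.

(** <T x, y> only sees the part T S y of y, and <x, S y> only the part S T x
    of x, so that wfun_dot applies. *)
Lemma wfun_adj r (hr : winj r) x y :
  l2dot (wfun hr x) y = l2dot x (wfun (winj_conv hr) y).
Proof.
set T := wfun hr; set S := wfun _.
have -> : l2dot (T x) y = l2dot (T x) (T (S y)).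
  apply: l2dot_ext => j; have [[i [w h]]|h0] := wfun_case hr j; last first.
    by rewrite /T !h0 !rdotc0l.
  have hc : wconv r j i (Num.conj w) by rewrite /wconv conjCK.
  rewrite [T (S y) j](wfunE hr _ h) [S y i](wfunE (winj_conv hr) _ hc) mulrA.
  by rewrite (mulrC w) conj_mul1 ?mul1r//; exact: winj_norm1 hr h.
rewrite wfun_dot -/T -/S.
have -> : S (T (S y)) = S y.
  rewrite -[RHS](wfunK (winj_conv hr) y) -/S; congr S.
  by apply: l2_ext => j /=; rewrite wconvK.
apply: l2dot_ext => i.
have [[j [w h]]|h0] := wfun_case (winj_conv hr) i; last first.
  by rewrite /S !h0 !(rdotcC _ 0) !rdotc0l.
rewrite [S (T x) i](wfunE _ _ h) [T x j](wfunE hr _ h).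
by rewrite mulrA (mulrC w) conj_mul1 ?mul1r//; exact: winj_norm1 (winj_conv hr) h.
Qed.

Lemma wfun_bop r (hr : winj r) : adjoint_pair (wfun hr) (wfun (winj_conv hr)).
Proof.
split; first exact: wfun_adj.
  exact: wfunZ.
exists 1 => // x; rewrite mul1r /hnorm ler_wsqrtr//.
by apply: l2dot_le => N; exact: sum_wapp_le.
Qed.

Definition wop r (hr : winj r) : bop l2 := Bop (wfun_bop hr).

End square_summable.

(** * The Cuntz-Krieger family of an infinite path *)

Section degree.
Variables (k : nat) (L : kGraph k).
Implicit Types (la mu nu : L) (m n p : {ffun 'I_k -> nat}).

Lemma degree_addIr m n p : m + p = n + p -> m = n.
Proof.
move=> /ffunP e; apply/ffunP => i; have := e i; rewrite !ffunE.
exact: addIn.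
Qed.

Lemma factor_uniq la la' mu mu' : deg la = deg la' ->
  src la = rng mu -> src la' = rng mu' ->
  comp la mu = comp la' mu' -> la = la' /\ mu = mu'.
Proof.
move=> dl s s' e.
have dm : deg mu = deg mu'.
  apply: (@degree_addIr _ _ (deg la)).
  by rewrite addrC -(deg_comp s) e (deg_comp s') -dl addrC.
have [p [_ pU]] := factorisation (deg_comp s).
have e1 : p = (la, mu) by exact: pU.
have e2 : p = (la', mu') by apply: pU.
by move: e2; rewrite e1 => -[-> ->].
Qed.

Lemma comp_cancelr mu nu la : src mu = rng la -> src nu = rng la ->
  comp mu la = comp nu la -> mu = nu.
Proof.
move=> s s' e; have d : deg mu = deg nu.
  by apply: (@degree_addIr _ _ (deg la)); rewrite -!deg_comp// e.
by have [] := factor_uniq d s s' e.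
Qed.

Lemma comp_cancell la mu nu : src la = rng mu -> src la = rng nu ->
  comp la mu = comp la nu -> mu = nu.
Proof. by move=> s s' e; have [] := factor_uniq (erefl _) s s' e. Qed.

End degree.

Section orbit_representation.
Variables (R : realType) (k : nat) (L : kGraph k) (c : L -> L -> R[i]).
Hypothesis cocycle_c : twisting_cocycle c.
Variable alpha : nat -> L.
Hypothesis alpha_comp : forall j, src (alpha j) = rng (alpha j.+1).
Hypothesis alpha_deg : forall j i, (0 < deg (alpha j) i)%N.
Implicit Types (la mu nu : L) (j : nat) (v : obj L) (w : R[i]).

Let vert j := rng (alpha j).

(** The path nu with mu = nu alpha_j, when there is one. *)
Definition peel j mu : option L :=
  if pselect (exists nu, src nu = rng (alpha j) /\ mu = comp nu (alpha j))
    is left e then Some (projT1 (cid e)) else None.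

Lemma peel_comp j nu : src nu = vert j -> peel j (comp nu (alpha j)) = Some nu.
Proof.
move=> s; rewrite /peel; case: pselect => [e|[]]; last by exists nu.
by case: cid => nu' /= [s' /(comp_cancelr s s') ->].
Qed.

Lemma peel_some j mu nu : peel j mu = Some nu ->
  src nu = vert j /\ mu = comp nu (alpha j).
Proof. by rewrite /peel; case: pselect => // e; case: cid => ? /= ? [<-]. Qed.

(** The germ of a path mu ending at rng (alpha j): as many of the segments
    alpha (j - 1), alpha (j - 2), ... as possible are removed from the end of
    mu, and the stage reached is recorded. *)
Fixpoint germ j mu : L * nat :=
  if j is j'.+1 then if peel j' mu is Some nu then germ j' nu else (mu, j)
  else (mu, 0%N).

(** The scalar relating, in the direct limit, the basis vector of mu at stage
    j to the one of its germ: removing alpha_j from nu alpha_j costs the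
    conjugate of c(nu, alpha_j). *)
Fixpoint phase j mu : R[i] :=
  if j is j'.+1 then
    if peel j' mu is Some nu then Num.conj (c nu (alpha j')) * phase j' nu
    else 1
  else 1.

Lemma germ_step j mu : src mu = vert j ->
  germ j.+1 (comp mu (alpha j)) = germ j mu.
Proof. by move=> s /=; rewrite peel_comp. Qed.

Lemma phase_step j mu : src mu = vert j ->
  phase j.+1 (comp mu (alpha j)) = Num.conj (c mu (alpha j)) * phase j mu.
Proof. by move=> s /=; rewrite peel_comp. Qed.

Lemma norm_cocycle mu nu : src mu = rng nu -> `|c mu nu| = 1.
Proof. by case: cocycle_c => h _ _; exact: h. Qed.

Lemma norm_phase j mu : `|phase j mu| = 1.
Proof.
elim: j mu => [|j IH] mu /=; first exact: normr1.
case E : (peel j mu) => [nu|]; last exact: normr1.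
by rewrite normrM norm_conjC IH norm_cocycle ?mul1r//; case: (peel_some E).
Qed.

Lemma germ_level j mu : ((germ j mu).2 <= j)%N.
Proof.
elim: j mu => //= j IH mu; case: (peel j mu) => //= nu.
exact: leq_trans (IH nu) (leqnSn _).
Qed.

(** A path that can be shortened and one that cannot have different germs
    because the germ of the former has a smaller stage. *)
Lemma germ_inj j mu mu' : germ j mu = germ j mu' -> mu = mu'.
Proof.
elim: j mu mu' => [|j IH] mu mu' /=; first by case.
case E : (peel j mu) => [nu|]; case E' : (peel j mu') => [nu'|].
- by move=> /IH h; case: (peel_some E) (peel_some E') => _ -> [_ ->]; rewrite h.
- by move=> h; have := germ_level j nu; rewrite h /= ltnn.
- by move=> h; have := germ_level j nu'; rewrite -h /= ltnn.
- by case.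
Qed.

Definition index j mu : nat := pickle (germ j mu).

Lemma index_inj j mu mu' : index j mu = index j mu' -> mu = mu'.
Proof. by move=> /(pcan_inj pickleK)/germ_inj. Qed.

(** The rule e_mu |-> c(la, mu) e_(la mu) of stage j, rewritten in terms of
    germs. *)
Definition acts_at la j g g' w : Prop := exists mu,
  [/\ src mu = vert j, src la = rng mu, g = index j mu,
      g' = index j (comp la mu) &
      w = Num.conj (phase j mu) * c la mu * phase j (comp la mu)].

Definition acts la g g' w : Prop := exists j, acts_at la j g g' w.

(** Compatibility of the action with the connecting isometries of the direct
    limit; for the weights this is the cocycle identity at (la, mu, alpha_j). *)
Lemma acts_at_step la j g g' w : acts_at la j g g' w -> acts_at la j.+1 g g' w.
Proof.
case=> mu [s sl -> -> ->]; exists (comp mu (alpha j)).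
have s' : src (comp la mu) = vert j by rewrite src_comp.
have r' : rng (comp mu (alpha j)) = rng mu by rewrite rng_comp.
split.
- by rewrite src_comp.
- by rewrite r'.
- by rewrite /index germ_step.
- by rewrite compA// /index germ_step.
rewrite compA// !phase_step//.
have [_ _ /(_ la mu (alpha j) sl s) e] := cocycle_c.
have n1 := norm_cocycle s'.
rewrite rmorphM /= conjCK.
transitivity (Num.conj (phase j mu) * phase j (comp la mu) *
  (c la mu * c (comp la mu) (alpha j)) * Num.conj (c (comp la mu) (alpha j))).
  by rewrite -[LHS]mulr1 -(conj_mul1 n1); ring.
by rewrite e; ring.
Qed.

Lemma acts_at_mono la j j' g g' w : (j <= j')%N ->
  acts_at la j g g' w -> acts_at la j' g g' w.
Proof. by move=> /subnK <-; elim: (j' - j)%N => // p IH /IH/acts_at_step. Qed.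

Lemma acts_common la la' g1 g2 w g1' g2' w' :
  acts la g1 g2 w -> acts la' g1' g2' w' ->
  exists j, acts_at la j g1 g2 w /\ acts_at la' j g1' g2' w'.
Proof.
move=> [j h] [j' h']; exists (maxn j j').
by split; [apply: acts_at_mono h; exact: leq_maxl|
           apply: acts_at_mono h'; exact: leq_maxr].
Qed.

(** Once two rules are brought to a common stage, equality of germs is equality
    of paths, and cancellation in Lambda applies. *)
Lemma winj_acts la : winj (acts la).
Proof.
split.
- move=> g g1 g2 w1 w2 h1 h2; have [j [{}h1 {}h2]] := acts_common h1 h2.
  case: h1 h2 => m1 [_ _ -> -> ->] [m2 [_ _ e -> ->]].
  by rewrite (index_inj e).
- move=> g1 g2 g w1 w2 h1 h2; have [j [{}h1 {}h2]] := acts_common h1 h2.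
  case: h1 h2 => m1 [_ r1 -> -> _] [m2 [_ r2 -> e _]].
  by rewrite (comp_cancell r1 r2 (index_inj e)).
- move=> g g' w [j [mu [s r _ _ ->]]].
  by rewrite !normrM norm_conjC !norm_phase norm_cocycle// !mulr1.
Qed.

(** The phases at the intermediate germ cancel, and the cocycle identity at
    (mu, nu, m1) turns the remaining weights into c(mu, nu) times the weight of
    the composite. *)
Lemma acts_comp mu nu g g' g'' w1 w2 : src mu = rng nu ->
  acts nu g g' w1 -> acts mu g' g'' w2 ->
  exists2 w, acts (comp mu nu) g g'' w & w2 * w1 = c mu nu * w.
Proof.
move=> mn h1 h2; have [j [{}h1 {}h2]] := acts_common h1 h2.
case: h1 h2 => m1 [s1 r1 -> -> ->] [m2 [s2 r2 e -> ->]].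
have {e} em := index_inj e; subst m2.
eexists; first exists j, m1; first split=> //.
  by rewrite src_comp.
  by rewrite compA.
rewrite compA//.
have [_ _ /(_ mu nu m1 mn r1) e] := cocycle_c.
transitivity (Num.conj (phase j m1) * phase j (comp (comp mu nu) m1) *
   (c nu m1 * c mu (comp nu m1)) *
   (Num.conj (phase j (comp nu m1)) * phase j (comp nu m1))); first by ring.
by rewrite conj_mul1 ?norm_phase// -e; ring.
Qed.

Lemma acts_split mu nu g g'' w : src mu = rng nu ->
  acts (comp mu nu) g g'' w ->
  exists g' w1 w2, acts nu g g' w1 /\ acts mu g' g'' w2.
Proof.
move=> mn [j [m [s r -> -> _]]]; move: r; rewrite src_comp// => r.
exists (index j (comp nu m)); do 2 eexists; split; exists j.
  by exists m; split.
exists (comp nu m); split=> //; first by rewrite src_comp.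
  by rewrite rng_comp.
by rewrite compA.
Qed.

Definition has_range v g : Prop :=
  exists j mu, [/\ src mu = vert j, rng mu = v & g = index j mu].

Lemma acts_idm v g g' w : acts (idm v) g g' w -> g = g' /\ w = 1.
Proof.
case=> j [mu [s r -> -> ->]]; have r' : v = rng mu by rewrite -r src_idm.
subst v; rewrite comp_idl; split=> //.
have [_ -> //] := cocycle_c; last by left; exact: deg_idm.
by rewrite mulr1 conj_mul1// norm_phase.
Qed.

Lemma has_rangeP v g : has_range v g <-> acts (idm v) g g 1.
Proof.
split=> [[j [mu [s r gE]]]|[j [mu [s r gE _ _]]]].
  suff [g' [w h]] : exists g' w, acts (idm v) g g' w.
    by have [e1 e2] := acts_idm h; move: h; rewrite -e1 e2.
  by do 2 eexists; exists j, mu; split=> //; rewrite src_idm r.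
by exists j, mu; split=> //; rewrite -r src_idm.
Qed.

Lemma has_range_src la g : has_range (src la) g <-> exists g' w, acts la g g' w.
Proof.
split=> [[j [mu [s r gE]]]|[g' [w [j [mu [s r gE _ _]]]]]].
  by do 2 eexists; exists j, mu; split.
by exists j, mu.
Qed.

Lemma has_range_rng la g g' w : acts la g g' w -> has_range (rng la) g'.
Proof.
case=> j [mu [s r _ -> _]]; exists j, (comp la mu).
by rewrite src_comp// rng_comp.
Qed.

Lemma has_range_uniq v v' g : has_range v g -> has_range v' g -> v = v'.
Proof.
move=> /has_rangeP h /has_rangeP h'; have [j [{}h {}h']] := acts_common h h'.
case: h h' => m [_ r -> _ _] [m' [_ r' e _ _]].
by rewrite -(src_idm v) r (index_inj e) -r' src_idm.
Qed.

(** Each step along the infinite path raises every coordinate of the degree of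
    a representative. *)
Lemma has_range_deep v g p : has_range v g -> exists j mu,
  [/\ src mu = vert j, rng mu = v, g = index j mu &
      forall i, (p <= deg mu i)%N].
Proof.
move=> vg; elim: p => [|p [j [mu [s r e d]]]].
  by case: vg => j [mu [s r e]]; exists j, mu; split.
exists j.+1, (comp mu (alpha j)); split.
- by rewrite src_comp.
- by rewrite rng_comp.
- by rewrite /index germ_step.
by move=> i; rewrite deg_comp// !ffunE -addn1 leq_add.
Qed.

(** The existence half of the last Cuntz-Krieger relation. *)
Lemma has_range_path v n g : has_range v g -> exists la g' w,
  paths_to v n la /\ acts la g' g w.
Proof.
move=> /(@has_range_deep _ _ (\max_i n i)) [j [mu [s r -> d]]].
have dE : deg mu = n + [ffun i => (deg mu i - n i)%N].
  apply/ffunP => i; rewrite !ffunE; apply/esym/subnKC.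
  by apply: leq_trans (d i); exact: leq_bigmax.
have [[la nu] [[/= dl _ sl e] _]] := factorisation dE.
exists la; do 2 eexists; split.
  by split=> //; rewrite -r e rng_comp.
by exists j, nu; split=> //; rewrite ?e// -s e src_comp.
Qed.

(** The uniqueness half of the last Cuntz-Krieger relation. *)
Lemma path_uniq la la' g1 g2 g w w' : deg la = deg la' ->
  acts la g1 g w -> acts la' g2 g w' -> la = la'.
Proof.
move=> d h h'; have [j [{}h {}h']] := acts_common h h'.
case: h h' => m1 [_ r1 _ -> _] [m2 [_ r2 _ e _]].
by have [] := factor_uniq d r1 r2 (index_inj e).
Qed.

Definition path_op la : bop (l2 R) := wop (winj_acts la).

Lemma path_opE la g g' w (x : l2 R) : acts la g g' w ->
  path_op la x g' = w * x g.
Proof. exact: wfunE. Qed.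

Lemma path_op0 la g' (x : l2 R) : (forall g w, ~ acts la g g' w) ->
  path_op la x g' = 0.
Proof. exact: wfun0. Qed.

Lemma path_op_adjE la g g' w (x : l2 R) : acts la g g' w ->
  (path_op la)^#%cstar x g = Num.conj w * x g'.
Proof.
move=> h; apply: (wfunE (winj_conv (winj_acts la))).
by rewrite /wconv conjCK.
Qed.

Lemma path_op_adj0 la g (x : l2 R) : (forall g' w, ~ acts la g g' w) ->
  (path_op la)^#%cstar x g = 0.
Proof. by move=> h; apply: wfun0 => g' w; rewrite /wconv; exact: h. Qed.

Lemma norm_acts la g g' w : acts la g g' w -> `|w| = 1.
Proof. exact: winj_norm1 (winj_acts la). Qed.

Lemma path_op_idmE v g (x : l2 R) : has_range v g -> path_op (idm v) x g = x g.
Proof. by move=> /has_rangeP/path_opE ->; rewrite mul1r. Qed.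

Lemma path_op_idm0 v g (x : l2 R) : ~ has_range v g -> path_op (idm v) x g = 0.
Proof.
move=> h; apply: path_op0 => g' w /has_range_rng; rewrite rng_idm.
exact: h.
Qed.

Lemma path_op_projE la g g' w (x : l2 R) : acts la g g' w ->
  path_op la ((path_op la)^#%cstar x) g' = x g'.
Proof.
move=> h; rewrite (path_opE _ h) (path_op_adjE _ h) mulrA (mulrC w).
by rewrite conj_mul1 ?mul1r// (norm_acts h).
Qed.

Lemma path_opM mu nu : src mu = rng nu ->
  (path_op mu ** path_op nu = c mu nu *: path_op (comp mu nu))%cstar.
Proof.
move=> mn; apply: bop_ext => x; apply: l2_ext => g''.
have [[g [w h]]|no] := pselect (exists g w, acts (comp mu nu) g g'' w).
  have [g' [w1 [w2 [h1 h2]]]] := acts_split mn h.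
  have [w' h' e] := acts_comp mn h1 h2.
  rewrite [LHS](path_opE _ h2) (path_opE _ h1) mulrA e.
  by rewrite [RHS]l2ZE (path_opE _ h') mulrA.
rewrite [RHS]l2ZE path_op0 ?mulr0; last by move=> g w h; apply: no; exists g, w.
have [[g' [w2 h2]]|no2] := pselect (exists g w, acts mu g g'' w); last first.
  by apply: path_op0 => g w h; apply: no2; exists g, w.
rewrite [LHS](path_opE _ h2) path_op0 ?mulr0// => g w1 h1.
by apply: no; have [w h _] := acts_comp mn h1 h2; exists g, w.
Qed.

Lemma path_op_adjM la :
  ((path_op la)^# ** path_op la = path_op (idm (src la)))%cstar.
Proof.
apply: bop_ext => x; apply: l2_ext => g.
have [vg|vg] := pselect (has_range (src la) g).
  rewrite path_op_idmE//; have [g' [w h]] := (has_range_src la g).1 vg.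
  rewrite [LHS](path_op_adjE _ h) (path_opE _ h) mulrA.
  by rewrite conj_mul1 ?mul1r// (norm_acts h).
rewrite path_op_idm0//; apply: path_op_adj0 => g' w h.
by apply/vg/has_range_src; exists g', w.
Qed.

Lemma bop_sumE (I : Type) (s : seq I) (F : I -> bop (l2 R)) (x : l2 R) g :
  (\sum_(i <- s) F i) x g = \sum_(i <- s) F i x g.
Proof.
by elim: s => [|i s IH]; rewrite ?big_nil// !big_cons -IH.
Qed.

(** In the last relation, at a germ with range v exactly one of the projections
    t_la t_la^* is nonzero, and it fixes that coordinate; elsewhere all vanish.
    The projections t_v are self-adjoint because t_v = t_v^* t_v. *)
Lemma path_op_CK : row_finite L -> CK_family c path_op.
Proof.
move=> rf; split.
- have idemp v : (path_op (idm v) ** path_op (idm v) = path_op (idm v))%cstar.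
    have cv : c (idm v) (idm v) = 1.
      by case: cocycle_c => _ -> //; rewrite ?src_idm ?rng_idm//; left; exact: deg_idm.
    rewrite path_opM ?src_idm ?rng_idm// cv scale1r.
    by rewrite -{1}(rng_idm v) comp_idl.
  split.
    move=> v; split; first exact: idemp.
    have E := path_op_adjM (idm v); rewrite src_idm in E.
    by rewrite -{1}E cadjM cadjK.
  move=> v v' vv'; apply: bop_ext => x; apply: l2_ext => g.
  have [vg|vg] := pselect (has_range v g); last exact: path_op_idm0.
  rewrite [LHS](path_op_idmE _ vg); apply: path_op_idm0 => v'g.
  exact: vv' (has_range_uniq vg v'g).
- exact: path_opM.
- exact: path_op_adjM.
move=> v n; have /finite_seqP[e0 e0E] := rf v n.
pose e := undup e0; have eE : paths_to v n = [set` e].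
  by rewrite e0E; apply/seteqP; split=> la /=; rewrite mem_undup.
rewrite eE -fsbig_seq ?undup_uniq//; apply: bop_ext => x; apply: l2_ext => g.
rewrite bop_sumE.
have mem_paths la : la \in e -> paths_to v n la by rewrite eE.
have [vg|vg] := pselect (has_range v g).
  have [la [g' [w [pla h]]]] := has_range_path n vg.
  have lae : la \in e by move: (pla); rewrite eE.
  rewrite path_op_idmE// (bigD1_seq la) ?undup_uniq//=.
  rewrite [X in X + _](path_op_projE _ h).
  rewrite big_seq_cond big1 ?addr0// => la' /andP[/mem_paths[_ dla'] /eqP ne].
  change (path_op la' ((path_op la')^#%cstar x) g = 0).
  apply: path_op0 => g2 w2 h2; apply: ne; apply: path_uniq h2 h.
  by rewrite dla' pla.2.
rewrite path_op_idm0// big_seq big1// => la /mem_paths[rla _].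
change (path_op la ((path_op la)^#%cstar x) g = 0).
by apply: path_op0 => g' w /has_range_rng; rewrite rla; exact: vg.
Qed.

Lemma square_summable_delta (g : nat) :
  square_summable (fun i => (i == g)%:R : R[i]).
Proof.
exists 1 => N; under eq_bigr => i _.
  have -> : sqc ((i == g)%:R : R[i]) = (i == g)%:R.
    by case: eqP => _; rewrite /sqc /rdotc /= ?mulr0 ?mulr1 addr0.
  over.
have -> : \sum_(0 <= i < N) (i == g)%:R = (count_mem g (index_iota 0 N))%:R :> R.
  by rewrite -sum1_count natr_sum [RHS]big_mkcond; apply: eq_bigr => i _ /=; case: (i == g).
by rewrite count_uniq_mem ?iota_uniq// (ler_nat _ _ 1) leq_b1.
Qed.

(** The basis vector of the germ of the identity at the start of the infinite
    path is fixed. *)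
Lemma path_op_idm_neq0 : path_op (idm (rng (alpha 0))) <> 0.
Proof.
set v := rng _ => T0; pose g := index 0 (idm v).
have vg : has_range v g by exists 0%N, (idm v); rewrite src_idm rng_idm.
have := path_op_idmE (L2 (square_summable_delta g)) vg.
by rewrite T0 /= eqxx => /esym/eqP; rewrite oner_eq0.
Qed.

End orbit_representation.

Lemma infinite_path (k : nat) (L : kGraph k) (v : obj L) : no_sources L ->
  exists alpha : nat -> L, [/\ rng (alpha 0) = v,
    (forall j, src (alpha j) = rng (alpha j.+1)) &
    forall j i, (0 < deg (alpha j) i)%N].
Proof.
move=> ns; have [e he] := choice (fun u : obj L => ns u [ffun=> 1%N]).
exists (fun j => e (iter j (fun u => src (e u)) v)); split.
- by have [] := he v.
- by move=> j /=; set u := iter _ _ _; have [-> _] := he (src (e u)).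
- by move=> j i; have [_ ->] := he (iter j (fun u => src (e u)) v); rewrite ffunE.
Qed.

Lemma star_hom0 (R : realType) (A B : cstarAlgType R) (f : A -> B) :
  star_hom f -> f 0 = 0.
Proof.
by case=> fl _ _; have := fl (-1) 0 0; rewrite scaleN1r oppr0 addr0 scaleN1r addNr.
Qed.

Theorem corollary6p8 (R : realType) (k : nat) (L : kGraph k)
    (c : L -> L -> R[i]) (A : cstarAlgType R) (s : L -> A) :
  row_finite L -> no_sources L -> twisting_cocycle c ->
  universal_CK_family c s ->
  forall la : L, s la <> 0.
Proof.
move=> rf ns cc [_ _ univ] la sla0.
have [alpha [a0 ac ad]] := infinite_path (src la) ns.
have [f [fhom fs]] := univ _ _ (path_op_CK cc ac ad rf).
apply: (@path_op_idm_neq0 _ _ _ _ cc _ ac); rewrite a0 -path_op_adjM.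
rewrite -fs sla0 (star_hom0 fhom).
by apply: bop_ext => x; exact: bfun0.
Qed.
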